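(* Let $A$ be a complete ultrametric space or a self-similar set with the strong separation condition (SSC) and let $B$ be a compact metric space such that $\dim_H A > \overline{\dim}_B B$. Then $A$ can be mapped onto $B$ by a Lipschitz map.
   Context: $\dim_H$ denotes Hausdorff dimension. For a compact metric space $X$ and $r>0$ let $N(X,r)$ be the minimal number of closed balls of radius $r$ that cover $X$; the upper box dimension is $\overline{\dim}_B X=\limsup_{r\to 0+}\frac{\log N(X,r)}{\log(1/r)}$. A metric space $(X,d)$ is ultrametric if $d(x,y)\le\max\{d(x,z),d(y,z)\}$ for all $x,y,z\in X$. A self-similar set is a nonempty compact set $K\subset\mathbb{R}^n$ with $K=\bigcup_{i=1}^m f_i(K)$ for finitely many contracting similarity maps $f_1,\dots,f_m$; it satisfies the strong separation condition (SSC) if $f_i(K)\cap f_j(K)=\emptyset$ for all $1\le i<j\le m$. A map $f\colon X\to Y$ between metric spaces $(X,d_X)$ and $(Y,d_Y)$ is Lipschitz if there is a finite constant $C$ with $d_Y(f(x),f(z))\le C\,d_X(x,z)$ for all $x,z\in X$.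
   Formalization: The complete ultrametric space A is assumed separable (otherwise a discrete A of size aleph_1 has infinite Hausdorff dimension but maps onto [0,1] only under the continuum hypothesis), and B is assumed nonempty. *)

(* Defs.v *)
From HB Require Import structures.
From mathcomp Require Import all_boot all_order all_algebra.
From mathcomp Require Import all_classical all_reals all_analysis.
From mathcomp Require Import ring.

Set Implicit Arguments.
Unset Strict Implicit.
Unset Printing Implicit Defensive.

Import Order.TTheory GRing.Theory Num.Theory.
Import numFieldNormedType.Exports.

Local Open Scope classical_set_scope.
Local Open Scope ring_scope.

Section MetricNotions.
Context {R : realType} {T : metricType R}.
Local Open Scope ereal_scope.

(* The supremum of the empty set is -oo, so diam set0 = -oo. *)
Definition diam (U : set T) : \bar R :=
  ereal_sup [set (mdist p.1 p.2)%:E | p in U `*` U].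

(* The empty set has weight 0 for every s, including s = 0; for nonempty U and
   s = 0 the weight is 1, as x `^ 0 = 1 for every x. *)
Definition hausdorff_weight (s : R) (U : set T) : \bar R :=
  if U == set0 then 0 else poweR (diam U) s.

Definition hausdorff_premeasure (delta s : R) (A : set T) : \bar R :=
  ereal_inf [set \sum_(0 <= i <oo) hausdorff_weight s (U i) |
    U in [set U : nat -> set T | A `<=` \bigcup_i U i /\
                                 forall i, diam (U i) <= delta%:E]].

Definition hausdorff_measure (s : R) (A : set T) : \bar R :=
  ereal_sup [set hausdorff_premeasure delta s A |
    delta in [set delta : R | (0 < delta)%R]].

Definition hausdorff_dim (A : set T) : \bar R :=
  ereal_inf [set s%:E |
    s in [set s : R | (0 <= s)%R /\ hausdorff_measure s A = 0]].

End MetricNotions.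

Section SpaceNotions.
Context {R : realType} (X : metricType R).

(* The library's closed_ball is the closure of the open ball, which in a general
   metric space may be smaller than the closed ball used here. *)
Definition covering_number (r : R) : \bar R :=
  ereal_inf [set (n%:R)%:E | n in [set n : nat |
    exists c : 'I_n -> X, forall x, exists i, mdist x (c i) <= r]].

Definition upper_box_dim : \bar R :=
  limf_esup (fun r : R => (lne (covering_number r) * ((ln r^-1)^-1)%:E)%E) 0^'+.

Definition ultrametric : Prop :=
  forall x y z : X, mdist x y <= Num.max (mdist x z) (mdist y z).

(* The class completeType of the library is restricted to pointed spaces. *)
Definition complete_space : Prop :=
  forall F : set_system X, ProperFilter F -> cauchy F -> exists x : X, F --> x.

(* Hausdorff measures use countable covers, so a nonseparable space has infinite
   Hausdorff dimension even when it is discrete.  A discrete space of cardinality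
   aleph_1 with all distances equal to 1 is complete and ultrametric, and it maps
   onto the unit interval only under the continuum hypothesis. *)
Definition separable_space : Prop :=
  exists2 D : set X, countable D & dense D.

End SpaceNotions.

Definition lipschitz_in {R : realType} {X Y : metricType R}
    (A : set X) (f : X -> Y) : Prop :=
  exists C : R, forall x z, A x -> A z -> mdist (f x) (f z) <= C * mdist x z.

(* A map defined on A only is represented by a total map whose values outside A
   are irrelevant. *)
Definition maps_lipschitz_onto {R : realType} {X Y : metricType R}
    (A : set X) (B : set Y) : Prop :=
  exists2 f : X -> Y, lipschitz_in A f & f @` A = B.

(* R^n with the Euclidean distance; the library's own metric on row vectors is
   the one of the sup norm. *)
Definition euclid (R : realType) (n : nat) : Type := 'rV[R]_n.

Section Euclid.
Context {R : realType} {n : nat}.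
Implicit Types x y z : 'rV[R]_n.

Definition euclid_dist x y : R := Num.sqrt (\sum_(i < n) (x 0 i - y 0 i) ^+ 2).

Let sum_sqr_ge0 (a : 'I_n -> R) : 0 <= \sum_i a i ^+ 2.
Proof. by apply: sumr_ge0 => i _; exact: sqr_ge0. Qed.

Let cauchy_schwarz (a b : 'I_n -> R) :
  (\sum_i a i * b i) ^+ 2 <= (\sum_i a i ^+ 2) * (\sum_i b i ^+ 2).
Proof.
set AB := \sum_i a i * b i; set A := \sum_i a i ^+ 2; set B := \sum_i b i ^+ 2.
have B0 : 0 <= B by exact: sum_sqr_ge0.
have : 0 <= \sum_i (a i * B - b i * AB) ^+ 2 by exact: sum_sqr_ge0.
have -> : \sum_i (a i * B - b i * AB) ^+ 2 = B * (A * B - AB ^+ 2).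
  transitivity (\sum_i (a i ^+ 2 * B ^+ 2 - a i * b i * (2 * B * AB) +
                        b i ^+ 2 * AB ^+ 2)).
    by apply: eq_bigr => i _; ring.
  by rewrite big_split/= sumrB -!mulr_suml -/A -/AB -/B; ring.
have [B_gt0|] := ltrP 0 B; first by rewrite pmulr_rge0// subr_ge0.
move=> B_le0 _; have B_eq0 : B = 0 by apply/eqP; rewrite eq_le B_le0.
rewrite B_eq0 mulr0 /AB big1 ?expr0n// => i _.
move/eqP: B_eq0; rewrite /B psumr_eq0; last by move=> j _; exact: sqr_ge0.
by move/allP => /(_ i (mem_index_enum i))/=; rewrite sqrf_eq0 => /eqP ->; rewrite mulr0.
Qed.

Let euclid_distxx x : euclid_dist x x = 0.
Proof. by rewrite /euclid_dist big1 ?sqrtr0// => i _; rewrite subrr expr0n. Qed.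

Let euclid_dist_positivity x y : euclid_dist x y = 0 -> x = y.
Proof.
move/eqP; rewrite sqrtr_eq0 => le0.
have /eqP : \sum_i (x 0 i - y 0 i) ^+ 2 = 0.
  by apply/eqP; rewrite eq_le le0 sum_sqr_ge0.
rewrite psumr_eq0; last by move=> j _; exact: sqr_ge0.
move=> /allP eq0; apply/rowP => i; apply/eqP.
by rewrite -subr_eq0 -sqrf_eq0; exact: (eq0 i (mem_index_enum i)).
Qed.

Let euclid_dist_sym x y : euclid_dist x y = euclid_dist y x.
Proof. by congr Num.sqrt; apply: eq_bigr => i _; rewrite -sqrrN opprB. Qed.

Let euclid_dist_triangle y x z : euclid_dist x z <= euclid_dist x y + euclid_dist y z.
Proof.
pose a i := x 0 i - y 0 i; pose b i := y 0 i - z 0 i.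
have d0 u v : 0 <= euclid_dist u v by exact: sqrtr_ge0.
rewrite -(ler_pXn2r (n := 2))// ?nnegrE ?addr_ge0// sqrrD !sqr_sqrtr//.
have -> : \sum_i (x 0 i - z 0 i) ^+ 2 =
    \sum_i a i ^+ 2 + (\sum_i a i * b i) *+ 2 + \sum_i b i ^+ 2.
  rewrite -sumrMnl -!big_split/=; apply: eq_bigr => i _.
  by rewrite /a /b; ring.
rewrite lerD2r lerD2l lerMn2r/= (le_trans (ler_norm _))//.
by rewrite -sqrtr_sqr -sqrtrM// ler_wsqrtr.
Qed.

HB.instance Definition _ := Choice.on (euclid R n).
HB.instance Definition _ := isMetric.Build R (euclid R n)
  euclid_distxx euclid_dist_positivity euclid_dist_sym euclid_dist_triangle.

Lemma mdist_euclidE (x y : euclid R n) : mdist x y = euclid_dist x y.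
Proof. by []. Qed.

End Euclid.

Definition contracting_similarity {R : realType} {X : metricType R}
    (f : X -> X) : Prop :=
  exists2 r : R, 0 < r < 1 & forall x y, mdist (f x) (f y) = r * mdist x y.

Section SelfSimilar.
Context {R : realType} {n m : nat}.
Implicit Types (f : 'I_m -> euclid R n -> euclid R n) (K : set (euclid R n)).

Definition self_similar f K : Prop :=
  [/\ K !=set0, compact K, forall i, contracting_similarity (f i)
    & K = \bigcup_i (f i @` K)].

Definition strong_separation f K : Prop :=
  forall i j : 'I_m, (i < j)%N -> f i @` K `&` f j @` K = set0.

End SelfSimilar.

Definition self_similar_ssc {R : realType} {n : nat} (K : set (euclid R n)) :
    Prop :=
  exists (m : nat) (f : 'I_m -> euclid R n -> euclid R n),
    self_similar f K /\ strong_separation f K.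

(* Main.v *)
(* In an ultrametric space, or a self-similar set with separated pieces, the
   points within distance about 2^-k of each other form the classes of nested
   equivalence relations, so the space is the boundary of a countably branching
   tree.  Let w = 2^-s with upper_box_dim B < s < hausdorff_dim A.  Covering by
   tree nodes, a node of level k costing w^k, defines a content that is positive
   on A and, by strong subadditivity, continuous along increasing unions.  Hence
   a subset of content more than c contains a part, made of finitely many level-l
   classes, of content in ]c, c + w^l].  The points of 2^-j-nets of B form a tree
   with at most C 2^(tj) nodes at level j, where t < s, so A can pay w^(j + l) for
   every one of them: greedy splitting gives disjoint subsets of A, indexed by the
   net points and nested like them, those of level j being unions of classes of
   level j + l.  Sending each of these subsets near its net point defines, in the
   limit, a Lipschitz map; it is onto by Koenig's lemma. *)
Require Import Defs.
From mathcomp Require Import all_boot all_order all_algebra.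
From mathcomp Require Import all_classical all_reals all_analysis.
From mathcomp Require Import ring.

Set Implicit Arguments.
Unset Strict Implicit.
Unset Printing Implicit Defensive.

Import Order.TTheory GRing.Theory Num.Theory.
Import numFieldNormedType.Exports.

Local Open Scope classical_set_scope.
Local Open Scope ring_scope.

(** * Geometric bounds *)

Lemma ler_geometric {R : realType} (M : R) (k l : nat) : 0 <= M -> (k <= l)%N ->
  M / 2 ^+ l <= M / 2 ^+ k.
Proof.
move=> M0 kl; rewrite ler_wpM2l// lef_pV2 ?posrE ?exprn_gt0//.
by rewrite ler_weXn2l ?ler1n.
Qed.

Lemma le0_geometric {R : realType} (x M : R) :
  (forall k, x <= M / 2 ^+ k) -> x <= 0.
Proof.
move=> xM; rewrite leNgt; apply/negP => x0.
have M0 : 0 < M by rewrite (lt_le_trans x0)// (le_trans (xM 0%N))// expr0 divr1.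
have xM0 : 0 < M / x by rewrite divr_gt0.
have := archi_boundP (ltW xM0); set k := Num.bound _ => Mk.
have := xM k; rewrite leNgt => /negP; apply.
rewrite ltr_pdivrMr ?exprn_gt0// mulrC -ltr_pdivrMr//.
by rewrite (lt_trans Mk)// -natrX ltr_nat ltn_expl.
Qed.

Lemma exists_geometric_lt {R : realType} (M e : R) : 0 < e ->
  exists k, M / 2 ^+ k < e.
Proof.
move=> e0; apply: contrapT => /forallNP Mk; move: e0; rewrite ltNge => /negP; apply.
by apply: (@le0_geometric _ _ M) => k; rewrite leNgt; apply/negP; exact: Mk.
Qed.

(** * Content of unions of tree nodes *)

Section Content.
Context {R : realType} {T : Type} (code : nat -> T -> nat) (w : R).
Hypothesis code_nested :
  forall k x y, code k.+1 x = code k.+1 y -> code k x = code k y.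
Hypothesis w_ge0 : 0 <= w.
Implicit Types (S : set (nat * nat)) (U : set T).

(** A node is a pair of a level [k] and a class number [i], standing for the points [x] with
    [code k x = i]; a larger [k] means a finer class. *)
Definition node_covers S U := forall x, U x -> exists k, S (k, code k x).

Definition node_sum S : \bar R := \esum_(p in S) (w ^+ p.1)%:E.

Definition content U : \bar R :=
  ereal_inf [set node_sum S | S in [set S | node_covers S U]].

(** The maximal nodes of [S], restricted to nonempty classes. By nestedness, the choice of the
    witness [x] in the class does not matter. *)
Definition top_nodes S : set (nat * nat) :=
  [set p | S p /\ exists2 x, code p.1 x = p.2 &
                   forall k, (k < p.1)%N -> ~ S (k, code k x)].

Local Open Scope ereal_scope.

Lemma code_le j k x y : (j <= k)%N -> code k x = code k y -> code j x = code j y.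
Proof.
move=> /subnK <-; elim: (k - j)%N => // n IHn; rewrite addSn => /code_nested.
exact: IHn.
Qed.

Lemma node_sum_ge0 S : 0 <= node_sum S.
Proof. by apply: esum_ge0 => p _; rewrite lee_fin exprn_ge0. Qed.

Lemma node_sum_split P S :
  node_sum S = node_sum (S `&` P) + node_sum (S `&` ~` P).
Proof. by apply: esumID => p _; rewrite lee_fin exprn_ge0. Qed.

Lemma le_node_sum S S' : S `<=` S' -> node_sum S <= node_sum S'.
Proof.
move=> SS'; rewrite (node_sum_split S S') setIidr// leeDl//.
exact: node_sum_ge0.
Qed.

Lemma node_sum_setU S S' : node_sum (S `|` S') <= node_sum S + node_sum S'.
Proof.
rewrite (node_sum_split S) leeD//; apply: le_node_sum => p; first by case.
by move=> [[]].
Qed.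

Lemma content_ge0 U : 0 <= content U.
Proof. by apply: le_ereal_inf_tmp => _ [S _ <-]; exact: node_sum_ge0. Qed.

Lemma content_le_sum S U : node_covers S U -> content U <= node_sum S.
Proof. by move=> SU; apply: ereal_inf_lbound; exists S. Qed.

Lemma content_approx U (e : R) : content U \is a fin_num -> (0 < e)%R ->
  exists2 S, node_covers S U & node_sum S <= content U + e%:E.
Proof.
move=> Ufin e0; have [_ [S SU <-] /ltW ?] := lb_ereal_inf_adherent e0 Ufin.
by exists S.
Qed.

Lemma content_le U U' : U `<=` U' -> content U <= content U'.
Proof.
move=> UU'; apply: le_ereal_inf_tmp => _ [S SU <-].
by apply: content_le_sum => x /UU'; exact: SU.
Qed.

Lemma content_set0 : content set0 = 0.
Proof.
apply/eqP; rewrite eq_le content_ge0 andbT.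
rewrite (le_trans (content_le_sum (S := set0) _)) ?/node_sum ?esum_set0//.
Qed.

Lemma content_setU U U' : content (U `|` U') <= content U + content U'.
Proof.
have [Ufin|] := boolP (content U \is a fin_num); last first.
  by rewrite ge0_fin_numE ?content_ge0// ltey negbK => /eqP ->;
    rewrite addye ?leey// gt_eqF// (lt_le_trans _ (content_ge0 _)).
have [U'fin|] := boolP (content U' \is a fin_num); last first.
  by rewrite ge0_fin_numE ?content_ge0// ltey negbK => /eqP ->;
    rewrite addey ?leey// gt_eqF// (lt_le_trans _ (content_ge0 _)).
apply/lee_addgt0Pr => e e0; have e20 : (0 < e / 2)%R by rewrite divr_gt0.
have [S SU Sle] := content_approx Ufin e20.
have [S' SU' Sle'] := content_approx U'fin e20.
apply: (@le_trans _ _ (node_sum (S `|` S'))).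
  apply: content_le_sum => x [/SU|/SU'] [k ?]; exists k; [by left|by right].
rewrite (le_trans (node_sum_setU _ _))// (le_trans (leeD Sle Sle'))//.
by rewrite addeACA -EFinD -splitr.
Qed.

Lemma content_node (l i : nat) U : (forall x, U x -> code l x = i) ->
  content U <= (w ^+ l)%:E.
Proof.
move=> Ul; apply: (le_trans (content_le_sum (S := [set (l, i)]) _)).
  by move=> x /Ul <-; exists l.
by rewrite /node_sum esum_set1// lee_fin exprn_ge0.
Qed.

Lemma node_covers_top S U : node_covers S U -> node_covers (top_nodes S) U.
Proof.
move=> SU x Ux.
have exk : exists k, `[< S (k, code k x) >].
  by have [k ?] := SU _ Ux; exists k; exact/asboolP.
case: (ex_minnP exk) => k /asboolP Sk kmin; exists k; split=> //=; exists x => //.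
by move=> j jk Sj; have := kmin j; rewrite leqNgt jk => /(_ (asboolT Sj)).
Qed.

(* Strong subadditivity at the level of covers: the nodes that are repeated or
   lie below another node still cover the intersection. *)
Lemma node_sum_top S S' U U' : node_covers S U -> node_covers S' U' ->
  node_sum (top_nodes (S `|` S')) + content (U `&` U') <=
    node_sum S + node_sum S'.
Proof.
move=> SU SU'; set M := S `|` S'; set t := top_nodes M.
have -> : node_sum S + node_sum S' = node_sum M + node_sum (S `&` S').
  rewrite (node_sum_split S M) (node_sum_split S S') -/M setUK /M.
  rewrite (_ : (S `|` S') `&` ~` S = S' `&` ~` S); last first.
    by apply/seteqP; split => [p [[]//]|p [? ?]]; split=> //; right.
  by rewrite [S' `&` S]setIC addeAC -addeA.
have tM : t `<=` M by move=> p [].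
rewrite (node_sum_split t M) (setIidr tM).
rewrite -addeA leeD2l//; apply: le_trans (node_sum_setU _ _).
apply: content_le_sum => x [/SU[k Sk] /SU'[k' Sk']].
have lower (i j : nat) : (i < j)%N -> M (i, code i x) -> M (j, code j x) ->
    (M `&` ~` t) (j, code j x).
  move=> ij Mi Mj; split => // -[_ /= [y xy]] /(_ i ij); apply.
  by rewrite (code_le (ltnW ij) xy).
have [kk'|k'k|kk'] := ltngtP k k'.
- by exists k'; left; apply: lower kk' _ _; [left|right].
- by exists k; left; apply: lower k'k _ _; [right|left].
- by exists k; right; split => //; rewrite kk'.
Qed.

(** Near-optimal covers of the [F n] are merged one after another, keeping only top nodes; as [F n]
    lies in [F n.+1], strong subadditivity makes the excesses merely add up. The top nodes of all
    covers together cover the union, and finitely many of them always lie in one merged cover. *)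
Lemma content_bigcup (F : nat -> set T) (c : \bar R) :
  (forall n, F n `<=` F n.+1) -> (forall n, content (F n) <= c) ->
  content (\bigcup_n F n) <= c.
Proof.
move=> F_incr; case: c => [c| |] Fc; last 2 first.
- by rewrite leey.
- by have := le_trans (content_ge0 _) (Fc 0%N).
have Ffin n : content (F n) \is a fin_num.
  by rewrite ge0_fin_numE ?content_ge0// (le_lt_trans (Fc n)) ?ltry.
apply/lee_addgt0Pr => e e0.
have e_gt0 n : (0 < e / 2 ^+ n.+1)%R by rewrite divr_gt0// exprn_gt0.
have /choice[Q] : forall n, exists S, node_covers S (F n) /\
    node_sum S <= content (F n) + (e / 2 ^+ n.+1)%:E.
  by move=> n; have [S] := content_approx (Ffin n) (e_gt0 n); exists S.
move=> /all_and2[QF Qle].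
pose P := fix P n := if n is m.+1 then top_nodes (P m `|` Q m.+1) else Q 0%N.
have PF n : node_covers (P n) (F n).
  elim: n => //= n IHn; apply: node_covers_top => x /QF[k ?].
  by exists k; right.
(* The excesses [e / 2 ^+ i.+1] for [i <= n] sum up to [e - e / 2 ^+ n.+1]. *)
have Ple n : node_sum (P n) <= content (F n) + (e - e / 2 ^+ n.+1)%:E.
  elim: n => [|n IHn].
    rewrite (le_trans (Qle 0%N))// leeD2l// lee_fin expr1.
    by rewrite lerBrDr -splitr.
  have := node_sum_top (PF n) (QF n.+1); rewrite (setIidl (F_incr n)) => top_le.
  rewrite -(leeD2rE _ _ (Ffin n)); apply: le_trans top_le _.
  apply: le_trans (leeD IHn (Qle n.+1)) _.
  rewrite addeACA -EFinD [leRHS]addeAC [content (F n.+1) + _]addeC leeD2l//.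
  rewrite lee_fin [(2 ^+ n.+2)%R]exprS.
  have : (2 ^+ n.+1 != 0 :> R)%R by rewrite expf_neq0.
  by move: (2 ^+ n.+1)%R => q q0; rewrite le_eqVlt; apply/orP; left; apply/eqP; field.
pose Z := \bigcup_n Q n.
have PZ n : P n `<=` Z.
  elim: n => [|n IHn] p; first by exists 0%N.
  by case=> -[/IHn ? _|Qp _]; last exists n.+1.
(* A top node of [Z] survives every merge: the merged covers lie in [Z], so none of their coarser
   nodes contains its witness. *)
have Qtop n m p : (n <= m)%N -> Q n p -> top_nodes Z p -> P m p.
  move=> + Qp [_ [x xp xmin]]; elim: m => [|m IHm].
    by rewrite leqn0 => /eqP n0; move: Qp; rewrite n0.
  rewrite leq_eqVlt ltnS => nm; split.
    by case/orP: nm => [/eqP <-|/IHm ?]; [right|left].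
  by exists x => // k /xmin Zk [/PZ//|Qk]; apply: Zk; exists m.+1.
apply: (@le_trans _ _ (node_sum (top_nodes Z))).
  apply: content_le_sum; apply: node_covers_top => x [n _ /QF[k ?]].
  by exists k, n.
(* An [esum] is a supremum over finite sets [X]; the largest of the cover indices [l p] for [p] in
   [X] gives a merged cover containing [X]. *)
apply: ge_ereal_sup => _ [X [Xfin XZ] <-].
have /choice[l lP] : forall p, exists n, Z p -> Q n p.
  move=> p; have [[n _ ?]|?] := pselect (Z p); first by exists n.
  by exists 0%N.
have /finite_seqP[s sX] := Xfin.
have XP : X `<=` P (\max_(p <- s) l p)%N.
  move=> p Xp; have [Zp _] := XZ _ Xp; apply: (Qtop (l p)) (lP _ Zp) (XZ _ Xp).
  by apply: leq_bigmax_seq => //; move: Xp; rewrite sX.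
rewrite -esum_fset//; last by move=> p _; rewrite lee_fin exprn_ge0.
apply: le_trans (le_node_sum XP) _; apply: le_trans (Ple _) _.
rewrite leeD// lee_fin gerBl.
by rewrite ltW.
Qed.

End Content.

(** * Splitting along the tree of nets *)

Section Selection.
Context {R : realType} {T : Type} (code : nat -> T -> nat) (w : R).
Hypothesis code_nested :
  forall k x y, code k.+1 x = code k.+1 y -> code k x = code k y.
Hypothesis w_gt0 : 0 < w.

Local Notation content := (content code w).
Local Open Scope ereal_scope.

Let w_ge0 : (0 <= w)%R := ltW w_gt0.

(** The parts of [U] made of the first [n] classes increase to [U], so by [content_bigcup] one of
    them has content above [c]. For the least such [n], the last class added costs at most
    [w ^+ l]. *)
Lemma content_split (l : nat) (U : set T) (c : \bar R) :
  0 <= c -> c < content U -> exists n,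
    c < content (U `&` [set x | (code l x < n)%N]) <= c + (w ^+ l)%:E.
Proof.
move=> c0 cU; pose F n := U `&` [set x | (code l x < n)%N].
have exn : exists n, c < content (F n).
  apply: contrapT => /forallNP Fc; move: cU; rewrite ltNge => /negP; apply.
  have -> : U = \bigcup_n F n.
    apply/seteqP; split=> [x Ux|x [n _ []//]].
    by exists (code l x).+1 => //; split => //=.
  apply: content_bigcup => // n; last by rewrite leNgt; apply/negP; exact: Fc.
  by move=> x [Ux]; rewrite /= => /ltnW lt; split.
case: (ex_minnP exn) => -[|n] cn nmin.
  move: cn; rewrite (_ : F 0%N = set0) ?content_set0 ?ltNge ?c0//.
  by apply/seteqP; split => // x [].
exists n.+1; rewrite cn/=.
have Fn : F n.+1 `<=` F n `|` (U `&` [set x | code l x = n]).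
  move=> x [Ux]; rewrite /= ltnS leq_eqVlt => /orP[/eqP|] ?; [by right|by left].
apply: le_trans (content_le code w Fn) _.
apply: le_trans (content_setU code w_ge0 _ _) _.
apply: leeD.
  by rewrite leNgt; apply/negP => /nmin; rewrite ltnn.
by apply: (content_node (i := n) w_ge0) => x [].
Qed.

(** Greedy: a part of content just above [c i] is cut off [U]. It uses up at most [w ^+ l + c i], so
    by subadditivity the remainder can pay for the rest of [s]. Part and remainder are both unions
    of level-[l] classes within [U], which carries the saturation clause through the induction. *)
Lemma content_split_seq (l : nat) (c : nat -> \bar R) (s : seq nat) (U : set T) :
  uniq s -> (forall i, 0 <= c i) ->
  \sum_(i <- s) ((w ^+ l)%:E + c i) < content U ->
  exists (G : nat -> set T) (b : nat -> nat),
    (forall i, i \in s -> [/\ G i `<=` U, c i < content (G i),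
      (forall x, G i x -> (code l x < b i)%N) &
      (forall x y, G i x -> U y -> code l x = code l y -> G i y)]) /\
    (forall i j x, i \in s -> j \in s -> G i x -> G j x -> i = j).
Proof.
move=> + c0; elim: s U => [|i s IHs] U; first by exists (fun=> set0), (fun=> 0%N).
rewrite big_cons /= => /andP[is_ us] sumU.
have sum0 : 0 <= \sum_(j <- s) ((w ^+ l)%:E + c j).
  by apply: sume_ge0 => j _; rewrite adde_ge0// lee_fin exprn_ge0.
have ciU : c i < content U.
  apply: le_lt_trans sumU; rewrite -addeA addeCA leeDl// adde_ge0//.
  by rewrite lee_fin exprn_ge0.
have [n /andP[cF Fc]] := content_split l (c0 i) ciU.
set F := U `&` _ in cF Fc; pose U' := U `\` F.
have sumU' : \sum_(j <- s) ((w ^+ l)%:E + c j) < content U'.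
  rewrite ltNge; apply/negP => U'le; move: sumU; rewrite ltNge => /negP; apply.
  have UF : U `<=` F `|` U' by move=> x Ux; have [?|?] := pselect (F x); [left|right].
  apply: le_trans (content_le code w UF) _.
  apply: le_trans (content_setU code w_ge0 _ _) _.
  by rewrite leeD// addeC.
have [G [b [GP Gdisj]]] := IHs _ us sumU'.
exists (fun j => if j == i then F else G j), (fun j => if j == i then n else b j).
split=> [j|j k x]; rewrite !inE.
  case: eqVneq => [-> _|ji /= js].
    split=> //; first by move=> x [].
      by move=> x [].
    by move=> x y [Ux xn] Uy xy; split => //=; rewrite -xy.
  have [GU cG Gb Gsat] := GP _ js; split => //.
    by apply: subset_trans GU _ => x [].
  move=> x y Gx Uy xy; apply: (Gsat _ _ Gx _ xy); split=> // -[_ /= yn].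
  by have [Ux] := GU _ Gx; apply; split => //=; rewrite xy.
case: (eqVneq j i) => [->|ji]; case: (eqVneq k i) => [->|ki] //=.
- by move=> _ ks Fx Gx; have [GU _ _ _] := GP _ ks; have [] := GU _ Gx.
- by move=> js _ Gx Fx; have [GU _ _ _] := GP _ js; have [] := GU _ Gx.
- exact: Gdisj.
Qed.

Context (N : nat -> nat) (par : nat -> nat -> nat).
Hypothesis par_lt : forall j v, (v < N j.+1)%N -> (par j v < N j)%N.

Definition children j u := [seq v <- iota 0 (N j.+1) | par j v == u].

Fixpoint descendants i j u : nat :=
  if i is i'.+1 then (\sum_(v <- children j u) descendants i' j.+1 v)%N else 1%N.

Lemma mem_children j v : (v < N j.+1)%N -> v \in children j (par j v).
Proof. by move=> vN; rewrite mem_filter eqxx mem_iota. Qed.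

Lemma sum_descendants i j :
  (\sum_(u <- iota 0 (N j)) descendants i j u)%N = N (j + i)%N.
Proof.
elim: i j => [|i IHi] j.
  by rewrite addn0/= big_const_seq count_predT size_iota iter_addn_0 mul1n.
rewrite -addSnnS -IHi /=.
under eq_bigr do rewrite big_filter.
rewrite (exchange_big_dep xpredT)//=; apply: eq_big_seq => v.
rewrite mem_iota/= => vN.
rewrite (eq_bigl (pred1 (par j v))); last by move=> u /=; rewrite eq_sym.
rewrite -big_filter filter_pred1_uniq ?iota_uniq// ?mem_iota ?par_lt//.
by rewrite big_seq1.
Qed.

Context (l0 : nat).

(* The budget of a node pays one level-[j + i + l0] code class for each of its
   descendants [i] levels below. *)
Definition budget j u : \bar R :=
  \sum_(0 <= i <oo) (w ^+ (j + i + l0) * (descendants i j u)%:R)%:E.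

(** The budget of a node less the overshoot [w ^+ (j + l0)] allowed when its own set is cut out.
    Content above this amount suffices for splitting the set among the children. *)
Definition inner_budget j u := \sum_(v <- children j u) budget j.+1 v.

Let term_ge0 i j u : 0 <= (w ^+ (j + i + l0) * (descendants i j u)%:R)%:E.
Proof. by rewrite lee_fin mulr_ge0// exprn_ge0. Qed.

Lemma budgetE j u : budget j u = (w ^+ (j + l0))%:E + inner_budget j u.
Proof.
rewrite /budget nneseries_recl//= ?addn0 ?mulr1//; congr (_ + _).
rewrite /inner_budget /budget -nneseries_sum//.
rewrite -[LHS](nneseries_addn 1)//; apply: eq_eseriesr => i _.
rewrite addn1 sumEFin; congr (_ %:E).
by rewrite natr_sum mulr_sumr; apply: eq_bigr => v _; rewrite addSnnS.
Qed.

Lemma inner_budget_ge0 j u : 0 <= inner_budget j u.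
Proof. by apply: sume_ge0 => v _; apply: nneseries_ge0. Qed.

Lemma sum_budget :
  \sum_(u <- iota 0 (N 0)) budget 0 u =
    \sum_(0 <= i <oo) (w ^+ (i + l0) * (N i)%:R)%:E.
Proof.
rewrite /budget -nneseries_sum//; apply: eq_eseriesr => i _.
by rewrite sumEFin -mulr_sumr -natr_sum sum_descendants.
Qed.

(** The sets of level 0 are cut from [A] by [content_split_seq], and every later set is split among
    the children of its node. This never stops, since each set keeps content above its
    [inner_budget], the sum of the budgets of the children; for the same reason no set is empty. *)
Lemma tree_selection (A : set T) :
  \sum_(0 <= i <oo) (w ^+ (i + l0) * (N i)%:R)%:E < content A ->
  exists (U : nat -> nat -> set T) (b : nat -> nat), forall j,
    [/\ forall u, (u < N j)%N -> U j u !=set0 /\ U j u `<=` A,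
        forall v, (v < N j.+1)%N -> U j.+1 v `<=` U j (par j v),
        forall u v x, (u < N j)%N -> (v < N j)%N -> U j u x -> U j v x -> u = v,
        forall u x y, (u < N j)%N -> U j u x -> A y ->
          code (j + l0) x = code (j + l0) y -> U j u y &
        forall u x, (u < N j)%N -> U j u x -> (code (j + l0) x < b j)%N].
Proof.
rewrite -sum_budget => sumA.
pose good j X := [/\ forall u, (u < N j)%N ->
    X u `<=` A /\ inner_budget j u < content (X u),
  forall u v x, (u < N j)%N -> (v < N j)%N -> X u x -> X v x -> u = v,
  forall u x y, (u < N j)%N -> X u x -> A y ->
    code (j + l0) x = code (j + l0) y -> X u y &
  exists b, forall u x, (u < N j)%N -> X u x -> (code (j + l0) x < b)%N].
have bound_max n (b : nat -> nat) : exists b', forall u, (u < n)%N -> (b u <= b')%N.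
  exists (\max_(u < n) b u)%N => u un; exact: (leq_bigmax (Ordinal un)).
have [X0 X0good] : exists X, good 0%N X.
  have [||G [b [GP Gdisj]]] := @content_split_seq l0 (inner_budget 0)
      (iota 0 (N 0)) A (iota_uniq _ _).
  - by move=> i; exact: inner_budget_ge0.
  - by under eq_bigr => u _ do rewrite -[l0]add0n -budgetE.
  have mem u : (u < N 0)%N -> u \in iota 0 (N 0) by rewrite mem_iota.
  exists G; split.
  + by move=> u /mem/GP[].
  + by move=> u v x /mem uN /mem vN; exact: Gdisj.
  + by move=> u x y /mem/GP[_ _ _ sat]; exact: sat.
  + have [b' bb'] := bound_max (N 0) b; exists b' => u x uN Gx.
    by have [_ _ lt _] := GP _ (mem _ uN); rewrite (leq_trans (lt _ Gx))// bb'.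
have /choice[next nextP] : forall jX : nat * (nat -> set T), exists X',
    good jX.1 jX.2 -> good jX.1.+1 X' /\
      forall v, (v < N jX.1.+1)%N -> X' v `<=` jX.2 (par jX.1 v).
  move=> [j X] /=; have [|nX] := pselect (good j X); last by exists (fun=> set0).
  move=> [XA Xdisj Xsat _].
  have /choice[G GP] : forall u, exists Gb : (nat -> set T) * (nat -> nat),
      (u < N j)%N ->
      (forall i, i \in children j u -> [/\ Gb.1 i `<=` X u,
        inner_budget j.+1 i < content (Gb.1 i),
        (forall x, Gb.1 i x -> (code (j.+1 + l0) x < Gb.2 i)%N) &
        (forall x y, Gb.1 i x -> X u y -> code (j.+1 + l0) x = code (j.+1 + l0) y ->
           Gb.1 i y)]) /\
      (forall i k x, i \in children j u -> k \in children j u ->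
         Gb.1 i x -> Gb.1 k x -> i = k).
    move=> u; have [uN|uN] := pselect (u < N j)%N; last first.
      by exists (fun=> set0, fun=> 0%N).
    have [_ Xu] := XA _ uN.
    have [||G [b GP]] := @content_split_seq (j.+1 + l0) (inner_budget j.+1)
        (children j u) (X u) (filter_uniq _ (iota_uniq _ _)).
    + by move=> i; exact: inner_budget_ge0.
    + by under eq_bigr => v _ do rewrite -budgetE.
    + by exists (G, b).
  exists (fun v => (G (par j v)).1 v) => _.
  have GPv v : (v < N j.+1)%N -> _ := fun vN => (GP _ (par_lt vN)).1 v (mem_children vN).
  split; last by move=> v vN; have [] := GPv v vN.
  split.
  + move=> v vN; have [GX ? _ _] := GPv v vN; split => //.
    by apply: subset_trans GX _; exact: (XA _ (par_lt vN)).1.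
  + move=> u v x uN vN Gu Gv.
    have [GXu _ _ _] := GPv u uN; have [GXv _ _ _] := GPv v vN.
    have uv := Xdisj _ _ _ (par_lt uN) (par_lt vN) (GXu _ Gu) (GXv _ Gv).
    apply: (GP _ (par_lt uN)).2 Gu _; [exact: mem_children| |by rewrite uv].
    by rewrite uv; exact: mem_children.
  (* [sat] speaks of points of the parent's set only, so [y] is first placed there by saturation one
     level up. *)
  + move=> u x y uN Gu Ay xy; have [GXu _ _ sat] := GPv u uN.
    apply: (sat x _ _ _ (xy)) => //; apply: Xsat (par_lt uN) (GXu _ Gu) Ay _.
    by apply: (code_nested); rewrite -addSn.
  + have [b' bb'] := bound_max (N j.+1) (fun v => (G (par j v)).2 v).
    exists b' => u x uN Gx; have [_ _ lt _] := GPv u uN.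
    by rewrite (leq_trans (lt _ Gx))// bb'.
pose U := fix U j := if j is i.+1 then next (i, U i) else X0.
have Ugood j : good j (U j) by elim: j => //= j Uj; have [] := nextP (j, U j) Uj.
have /choice[b bP] : forall j, exists b, forall u x, (u < N j)%N -> U j u x ->
    (code (j + l0) x < b)%N by move=> j; have [] := Ugood j.
exists U, b => j; have [UA Udisj Usat _] := Ugood j; split => //.
- move=> u uN; have [UjA Uj] := UA _ uN; split => //.
  apply/set0P; apply: contraTneq (Uj) => ->.
  by rewrite content_set0// -leNgt inner_budget_ge0.
- by move=> v vN; have [_ UX] := nextP (j, U j) (Ugood j); exact: UX.
- exact: bP.
Qed.

End Selection.

(** * The limit map *)

Lemma compact_seq_cluster {R : realType} {X : metricType R} (K : set X)
    (x : nat -> X) : compact K -> (forall n, K (x n)) ->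
  exists2 p, K p & forall e n, 0 < e -> exists2 m, (n <= m)%N & mdist p (x m) < e.
Proof.
move=> cK Kx.
have [|p [Kp cp]] := cK (x @ \oo) _; first by exists 0%N => //= n _; exact: Kx.
exists p => // e n e0.
have [|q [[m /= nm <-]]] := cp (x @` [set m | (n <= m)%N]) _ _ (nbhsx_ballx p e e0).
  by exists n => // m /= nm; exists m.
by rewrite ballEmdist => ?; exists m.
Qed.

Lemma infinite_pigeonhole (Q : nat -> Prop) (v : nat -> nat) (b n0 : nat) :
  (forall n, exists2 j, (n <= j)%N & Q j) ->
  (forall j, (n0 <= j)%N -> (v j < b)%N) ->
  exists i, forall n, exists2 j, (n <= j)%N & Q j /\ v j = i.
Proof.
move=> Qinf vb; apply: contrapT => /forallNP noi.
have /choice[n nP] : forall i, exists n, forall j, (n <= j)%N -> ~ (Q j /\ v j = i).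
  move=> i; have /existsNP[n nP] := noi i; exists n => j nj Qj.
  by apply: nP; exists j.
have [j + Qj] := Qinf (maxn n0 (\max_(i < b) n i)).
rewrite geq_max => /andP[/vb vjb maxj]; apply: (nP (v j) j) => //.
by apply: leq_trans maxj; exact: (leq_bigmax (Ordinal vjb)).
Qed.

Section LimitMap.
Context {R : realType} {T B : metricType R} (A : set T) (code : nat -> T -> nat).
Context (c : R) (l0 : nat).
Hypothesis c_gt0 : 0 < c.
Hypothesis code_nested :
  forall k x y, code k.+1 x = code k.+1 y -> code k x = code k y.
Hypothesis code_sep : forall k x y, A x -> A y -> mdist x y < c / 2 ^+ k ->
  code k x = code k y.
Hypothesis code_complete : forall y : nat -> T, (forall k, A (y k)) ->
  (forall k, code k (y k) = code k (y k.+1)) ->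
  exists2 x, A x & forall k, code k x = code k (y k).
Hypothesis B_compact : compact [set: B].
Context (N : nat -> nat) (par : nat -> nat -> nat) (net : nat -> nat -> B) (M : R).
Hypothesis N0 : N 0 = 1%N.
Hypothesis par_lt : forall j v, (v < N j.+1)%N -> (par j v < N j)%N.
Hypothesis net_par : forall j v, (v < N j.+1)%N ->
  mdist (net j.+1 v) (net j (par j v)) <= M / 2 ^+ j.
Hypothesis net_cover : forall j b,
  exists2 u, (u < N j)%N & mdist b (net j u) <= M / 2 ^+ j.
Context (U : nat -> nat -> set T) (bd : nat -> nat).
Hypothesis U_neq0 : forall j u, (u < N j)%N -> U j u !=set0.
Hypothesis U_sub : forall j u, (u < N j)%N -> U j u `<=` A.
Hypothesis U_par : forall j v, (v < N j.+1)%N -> U j.+1 v `<=` U j (par j v).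
Hypothesis U_disj : forall j u v x, (u < N j)%N -> (v < N j)%N ->
  U j u x -> U j v x -> u = v.
Hypothesis U_sat : forall j u x y, (u < N j)%N -> U j u x -> A y ->
  code (j + l0) x = code (j + l0) y -> U j u y.
Hypothesis U_bd : forall j u x, (u < N j)%N -> U j u x -> (code (j + l0) x < bd j)%N.

Let M_ge0 : 0 <= M.
Proof.
have [u _] := net_cover 0 (net 0 0); rewrite expr0 divr1.
exact/le_trans/mdist_ge0.
Qed.

(** [f j] sends [U j u] to [net j u] and leaves every other point where the previous level put it;
    its steps are geometrically small, so it converges to a map [F]. On [A], [f j] depends only on
    the code of level [j + l0], and points with different codes there are at least
    [c / 2 ^+ (j + l0)] apart, so [F] is Lipschitz. *)
Lemma lipschitz_onto_of_tree : maps_lipschitz_onto A [set: B].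
Proof.
have /choice[idx idxP] : forall jx : nat * T, exists o : option nat,
    if o is Some u then (u < N jx.1)%N /\ U jx.1 u jx.2
    else forall u, (u < N jx.1)%N -> ~ U jx.1 u jx.2.
  move=> [j x] /=; have [[u Hu]|nU] := pselect (exists u, (u < N j)%N /\ U j u x).
    by exists (Some u).
  by exists None => u uN Ux; apply: nU; exists u.
pose f := fix f j x := if j is i.+1 then
  (if idx (j, x) is Some u then net j u else f i x) else net 0 0.
have fU j u x : (u < N j)%N -> U j u x -> f j x = net j u.
  case: j => [|j] uN Ux; first by move: uN; rewrite N0; case: u Ux.
  have := idxP (j.+1, x) => /=; case: (idx _) => [v [vN Vx]|/(_ _ uN)//].
  by rewrite (U_disj uN vN Ux Vx).
have f_step j x : mdist (f j.+1 x) (f j x) <= M / 2 ^+ j.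
  have := idxP (j.+1, x) => /=; case: (idx _) => [v [vN Vx]|_].
    by rewrite (fU _ _ _ (par_lt vN) (U_par vN Vx)) net_par.
  by rewrite mdistxx divr_ge0// exprn_ge0.
have f_tail j k x : (j <= k)%N -> mdist (f k x) (f j x) <= 2 * M / 2 ^+ j.
  (* The bound is sharpened to a telescoping one, which the induction on [k - j] preserves. *)
  move=> jk; apply: (@le_trans _ _ (2 * M / 2 ^+ j - 2 * M / 2 ^+ k)); last first.
    by rewrite gerBl divr_ge0// ?mulr_ge0// exprn_ge0.
  move: jk => /subnKC <-; elim: (k - j)%N => [|n IHn].
    by rewrite addn0 mdistxx subrr.
  rewrite addnS; apply: le_trans (metric_triangle _ (f (j + n)%N x) _) _.
  apply: le_trans (lerD (f_step _ _) IHn) _.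
  rewrite exprS; have : 2 ^+ (j + n) != 0 :> R by rewrite expf_neq0.
  move: (2 ^+ (j + n)) => q q0; rewrite le_eqVlt; apply/orP; left; apply/eqP.
  by field; rewrite q0 expf_neq0.
have f_const j x y : A x -> A y -> code (j + l0) x = code (j + l0) y ->
    f j x = f j y.
  move=> Ax Ay; elim: j => // j IHj xy.
  have := idxP (j.+1, y); have := idxP (j.+1, x) => /=.
  case: (idx (j.+1, x)) => [u [uN Ux]|nx]; case: (idx (j.+1, y)) => [v [vN Vy]|ny].
  - by rewrite (U_disj uN vN (U_sat uN Ux Ay xy) Vy).
  - by case: (ny _ uN (U_sat uN Ux Ay xy)).
  - by case: (nx _ vN (U_sat vN Vy Ax (esym xy))).
  - by apply: IHj; apply: code_nested.
(* The limit, a cluster point in the compact [B], is chosen as a function of the sequence [g] and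
   not of the point, so that points with the same sequence get the same image. *)
have /choice[lim limP] : forall g : nat -> B, exists b,
    (exists x, g = f^~ x) -> forall j, mdist b (g j) <= 2 * M / 2 ^+ j.
  move=> g; have [[x ->]|nx] := pselect (exists x, g = f^~ x); last by exists (net 0 0).
  have [b _ bP] := compact_seq_cluster (x := f^~ x) B_compact (fun=> I).
  exists b => _ j; apply/ler_addgt0Pr => e e0; have [k jk /ltW bk] := bP e j e0.
  apply: le_trans (metric_triangle _ (f k x) _) _.
  by rewrite addrC lerD// f_tail.
pose F x := lim (f^~ x).
have FP j x : mdist (F x) (f j x) <= 2 * M / 2 ^+ j by apply: limP; exists x.
have F_close j x y : f j x = f j y -> mdist (F x) (F y) <= 4 * M / 2 ^+ j.
  move=> fxy; apply: le_trans (metric_triangle _ (f j x) _) _.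
  rewrite [mdist (f j x) _]metric_sym {2}fxy.
  apply: le_trans (lerD (FP _ _) (FP _ _)) _.
  by rewrite -mulrDl -mulrDl -natrD.
exists F.
  (* Let [j] be the first level with different codes. Then [x] and [y] are at least
     [c / 2 ^+ (j + l0)] apart, and [f] agrees on them at level [j - 1], so their images are within
     [4 * M / 2 ^+ (j - 1) = 8 * M / 2 ^+ j]. For [j = 0], the constant [f 0] gives [4 * M]. *)
  exists (8 * M * 2 ^+ l0 / c) => x y Ax Ay.
  have [xy|] := pselect (forall j, code (j + l0) x = code (j + l0) y).
    rewrite /F (_ : f^~ x = f^~ y) ?mdistxx ?mulr_ge0 ?mdist_ge0//.
    - by rewrite invr_ge0 ltW.
    - by apply/funext => j; exact: f_const.
  move=> /existsNP exj.
  have exj' : exists j, code (j + l0) x != code (j + l0) y.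
    by have [j /eqP] := exj; exists j.
  case: (ex_minnP exj') => j xy jmin.
  have dxy : c / 2 ^+ (j + l0) <= mdist x y.
    by rewrite leNgt; apply: contra xy => /code_sep -> //.
  apply: (@le_trans _ _ (8 * M / 2 ^+ j)); last first.
    apply: le_trans (ler_wpM2l _ dxy); last first.
      by rewrite divr_ge0 ?mulr_ge0 ?exprn_ge0// ltW.
    rewrite exprD le_eqVlt; apply/orP; left; apply/eqP; field.
    by rewrite !expf_neq0//= gt_eqF.
  case: j xy jmin dxy => [_ _ _|j _ jmin _].
    apply: le_trans (F_close 0%N x y erefl) _.
    by rewrite !expr0 !divr1 ler_wpM2r// ler_nat.
  have fj : f j x = f j y.
    apply: f_const => //; apply/eqP; apply: contraT => /jmin.
    by rewrite ltnn.
  apply: le_trans (F_close _ _ _ fj) _.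
  rewrite exprS le_eqVlt; apply/orP; left; apply/eqP; field.
  by rewrite expf_neq0.
apply/seteqP; split => // b _.
(* Surjectivity: [x j] lies in the set of a level-[j] net point close to [b], so [F (x j)] tends to
   [b]. *)
have /choice[x xP] : forall j, exists x, exists u, [/\ (u < N j)%N, U j u x &
    mdist b (net j u) <= M / 2 ^+ j].
  move=> j; have [u uN bu] := net_cover j b; have [x Ux] := U_neq0 uN.
  by exists x, u.
have Ax j : A (x j) by have [u [uN Ux _]] := xP j; exact: U_sub Ux.
have Fx j : mdist (F (x j)) b <= 3 * M / 2 ^+ j.
  have [u [uN Ux bu]] := xP j.
  apply: le_trans (metric_triangle _ (f j (x j)) _) _.
  rewrite (_ : 3 = 2 + 1 :> R); last by ring.
  rewrite 2!mulrDl mul1r lerD//.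
  by rewrite (fU _ _ _ uN Ux) metric_sym.
have anc j k u z : (k <= j)%N -> (u < N j)%N -> U j u z ->
    exists2 v, (v < N k)%N & U k v z.
  move=> /subnK <-; elim: (j - k)%N u => [|n IHn] u; first by exists u.
  by move=> uN /(U_par uN); apply: IHn; exact: par_lt.
have xbd k j : (k <= j)%N -> (code (k + l0) (x j) < bd k)%N.
  move=> kj; have [u [uN Ux _]] := xP j; have [v vN Vx] := anc _ _ _ _ kj uN Ux.
  exact: U_bd Vx.
(* Koenig's lemma: the sequence [x] has a subsequence whose codes converge. *)
pose often k z := A z /\ forall n,
  exists2 j, (n <= j)%N & code (k + l0) (x j) = code (k + l0) z.
have [z0 z0P] : exists z, often 0%N z.
  have [||i iP] := @infinite_pigeonhole (fun=> True)
    (fun j => code (0 + l0) (x j)) (bd 0) 0%N.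
  - by move=> n; exists n.
  - by move=> j; exact: xbd.
  have [j _ [_ ji]] := iP 0%N; exists (x j); split => // n.
  by have [m nm [_ mi]] := iP n; exists m => //; rewrite mi ji.
have /choice[next nextP] : forall kz : nat * T, exists z', often kz.1 kz.2 ->
    often kz.1.+1 z' /\ code (kz.1 + l0) kz.2 = code (kz.1 + l0) z'.
  move=> [k z] /=; have [[Az zP]|] := pselect (often k z); last by exists z.
  have [i iP] := infinite_pigeonhole zP (xbd k.+1).
  have [j _ [jz ji]] := iP 0%N; exists (x j) => _; split => //; split => // n.
  by have [m nm [_ mi]] := iP n; exists m => //; rewrite mi ji.
pose y := fix y k := if k is i.+1 then next (i, y i) else z0.
have yP k : often k (y k).
  by elim: k => //= k yk; have [] := nextP (k, y k) yk.
(* [y k] settles the code of level [k + l0], hence the shift; for [k <= l0] truncated subtraction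
   gives [y 0]. *)
have [p Ap pP] : exists2 p, A p & forall k, code k p = code k (y (k - l0)%N).
  apply: code_complete => [k|k]; first by have [] := yP (k - l0)%N.
  have [lk|kl] := leqP l0 k; last first.
    rewrite (_ : k - l0 = 0)%N 1?(_ : k.+1 - l0 = 0)%N//; apply/eqP.
      by rewrite subn_eq0.
    by rewrite subn_eq0 ltnW.
  have [_] := nextP (_, _) (yP (k - l0)%N).
  by rewrite /= subnK// subSn.
exists p => //; apply: mdist_positivity; apply/eqP; rewrite eq_le mdist_ge0 andbT.
(* Some [x j] with [j >= k] has the code of [p] at level [k + l0]. So [F p] is within
   [4 * M / 2 ^+ k] of [F (x j)], which is within [3 * M / 2 ^+ k] of [b]. *)
apply: (@le0_geometric _ _ (7 * M)) => k.
have [_ /(_ k)[j kj xj]] := yP k.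
have fpx : f k p = f k (x j) by apply: f_const => //; rewrite pP addnK xj.
apply: le_trans (metric_triangle _ (F (x j)) _) _.
rewrite (_ : 7 = 4 + 3 :> R); last by ring.
rewrite mulrDl mulrDl lerD// ?F_close// (le_trans (Fx j))//.
by rewrite ler_geometric// mulr_ge0.
Qed.

End LimitMap.

(** * Hausdorff and box dimensions *)

(** The series for [l = 0] is at most [C / (1 - w * D)], and shifting by [l] multiplies it by
    [w ^+ l]. *)
Lemma nneseries_geometric_small {R : realType} (w C D : R) (n : nat -> nat)
    (h : \bar R) :
  0 < w < 1 -> 0 <= C -> 0 <= D -> w * D < 1 ->
  (forall i, (n i)%:R <= C * D ^+ i) -> (0 < h)%E ->
  exists l, (\sum_(0 <= i <oo) (w ^+ (i + l) * (n i)%:R)%:E < h)%E.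
Proof.
move=> /andP[w0 w1] C0 D0 wD1 nCD h0.
have [e e0 eh] : exists2 e : R, 0 < e & (e%:E <= h)%E.
  case: h h0 => [r| |]//; first by rewrite lte_fin => r0; exists r.
  by exists 1 => //; rewrite leey.
pose K := C / (1 - w * D); have K0 : 0 <= K by rewrite divr_ge0// subr_ge0 ltW.
have [l Kl] : exists l, w ^+ l * K < e.
  have /cvgrPdist_lt/(_ e e0)[l _ /(_ l (leqnn l))] :
      geometric K w @ \oo --> (0 : R).
    by apply: cvg_geometric; rewrite ger0_norm ?ltW.
  rewrite /= sub0r normrN ger0_norm; last exact: mulr_ge0 K0 (exprn_ge0 _ (ltW w0)).
  by rewrite mulrC; exists l.
exists l; apply: lt_le_trans _ eh; apply: (@le_lt_trans _ _ (w ^+ l * K)%:E); last first.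
  by rewrite lte_fin.
have term_ge0 i : (0 <= (w ^+ (i + l) * (n i)%:R)%:E)%E.
  by rewrite lee_fin mulr_ge0// exprn_ge0// ltW.
apply: (lime_le (is_cvg_nneseries (fun i _ _ => term_ge0 i))); apply: nearW => m.
rewrite sumEFin lee_fin.
apply: (@le_trans _ _ (w ^+ l * (C * \sum_(0 <= i < m) (w * D) ^+ i))).
  rewrite !mulr_sumr ler_sum// => i _; rewrite addnC exprD -mulrA.
  by rewrite ler_wpM2l ?exprn_ge0 ?(ltW w0)// exprMn mulrCA ler_wpM2l// exprn_ge0// ltW.
rewrite ler_wpM2l ?exprn_ge0 ?(ltW w0)// ler_wpM2l//.
rewrite big_mkord -[leRHS]mul1r ler_pdivlMr ?subr_gt0//.
rewrite mulrC -opprB mulNr -subrX1 opprB gerBl.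
by rewrite exprn_ge0// mulr_ge0// ltW.
Qed.

(** * Comparison of the content with Hausdorff measure *)

Section HausdorffContent.
Context {R : realType} {T : metricType R} (A : set T) (code : nat -> T -> nat).
Context (C s : R).
Hypothesis C_gt0 : 0 < C.
Hypothesis s_gt0 : 0 < s.
Hypothesis code_dist : forall k x y, A x -> A y -> code k x = code k y ->
  mdist x y <= C / 2 ^+ k.
Local Open Scope ereal_scope.

Let w : R := (2 `^ (- s))%R.

Let w_gt0 : (0 < w)%R. Proof. exact: powR_gt0. Qed.

Let w_lt1 : (w < 1)%R.
Proof.
rewrite /w powRN invf_lt1 ?powR_gt0//.
by have := gt0_ltr_powR s_gt0 (x := 1%R) (y := 2%R);
  rewrite powR1 !nnegrE; apply; rewrite ?ltr1n.
Qed.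

Lemma hausdorff_weight_ge0 (U : set T) : 0 <= hausdorff_weight s U.
Proof. by rewrite /hausdorff_weight; case: ifP => // _; exact: poweR_ge0. Qed.

Let cell (p : nat * nat) := A `&` [set x | code p.1 x = p.2].

Let diam_cell p : diam (cell p) <= (C / 2 ^+ p.1)%:E.
Proof.
apply: ge_ereal_sup => _ [[x y] /= [[Ax xp] [Ay yp]] <-].
by rewrite lee_fin code_dist// xp yp.
Qed.

Let weight_cell p : hausdorff_weight s (cell p) <= (C `^ s)%:E * (w ^+ p.1)%:E.
Proof.
rewrite /hausdorff_weight; case: eqP => [_|/eqP/set0P[x px]].
  by rewrite -EFinM lee_fin mulr_ge0 ?powR_ge0 ?exprn_ge0// ltW.
have diam_ge0 : 0 <= diam (cell p).
  by apply: ereal_sup_ubound; exists (x, x) => //=; rewrite mdistxx.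
apply: le_trans (gt0_ler_poweR (ltW s_gt0) _ _ (diam_cell p)) _.
- by rewrite in_itv/= diam_ge0 leey.
- by rewrite in_itv/= leey lee_fin divr_ge0 ?exprn_ge0// ltW.
rewrite poweR_EFin -EFinM lee_fin powRM ?(ltW C_gt0)// ?invr_ge0 ?exprn_ge0//.
rewrite le_eqVlt; apply/orP; left; apply/eqP; congr *%R.
rewrite -(powR_invn _ (ler0n _ 2)) -powRrM.
by rewrite /w -powR_mulrn ?powR_ge0// -powRrM !mulNr [(s * _)%R]mulrC.
Qed.

(** By contraposition: zero content gives node covers of arbitrarily small sum. A small sum excludes
    coarse nodes, each of which alone costs too much, so these covers consist of cells of small
    diameter and bound the Hausdorff premeasures. *)
Lemma content_gt0 : hausdorff_measure s A != 0 -> 0 < content code w A.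
Proof.
move=> HA; rewrite lt_neqAle (content_ge0 code (ltW w_gt0)) andbT.
apply: contra_neq HA => A0; apply/eqP; rewrite eq_le; apply/andP; split; last first.
  apply: le_trans (ereal_sup_ubound (x := hausdorff_premeasure 1 s A) _).
    apply: le_ereal_inf_tmp => _ [U _ <-]; apply: nneseries_ge0 => i _ _.
    exact: hausdorff_weight_ge0.
  by exists 1%R => //=.
apply: ge_ereal_sup => _ [d /= d0 <-].
apply/lee_addgt0Pr => e e0; rewrite add0e.
have [k /ltW Ck] := exists_geometric_lt C d0.
have Cs0 : (0 < C `^ s)%R by exact: powR_gt0.
(* The first bound forces the nodes of [S] to levels at least [k], where cells have diameter at most
   [d]; the second bounds the total weight by [e]. *)
pose eps := Num.min (w ^+ k)%R (e / C `^ s)%R.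
have eps0 : (0 < eps)%R by rewrite lt_min exprn_gt0// divr_gt0.
have [_ [S SA <-] Seps] : exists2 y, [set node_sum w S | S in
    [set S | node_covers code S A]] y & y < eps%:E.
  by apply: ereal_inf_lt; rewrite -/(content code w A) -A0 lte_fin.
have Sk p : S p -> (k <= p.1)%N.
  move=> Sp; rewrite leqNgt; apply/negP => pk.
  have : [set p] `<=` S by move=> _ ->.
  move=> /(le_node_sum (ltW w_gt0)); rewrite {1}/node_sum esum_set1; last first.
    by rewrite lee_fin exprn_ge0// ltW.
  move=> /le_lt_trans/(_ Seps); rewrite lte_fin lt_min => /andP[+ _].
  by rewrite ltNge ler_wiXn2l ?(ltW w_gt0) ?(ltW w_lt1) ?(ltnW pk).
(* Nodes are enumerated by [pickle]; indices that belong to no node of [S] get the empty set, of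
   weight 0. *)
pose U n := if pickle_inv n is Some p then if p \in S then cell p else set0 else set0.
apply: (@le_trans _ _ (\sum_(0 <= i <oo) hausdorff_weight s (U i))).
  apply: ereal_inf_lbound; exists U => //; split.
    move=> x Ax; have [l Sl] := SA x Ax.
    exists (pickle (l, code l x)) => //; rewrite /U pickleK_inv.
    by rewrite mem_set.
  move=> i; have d00 : @diam R T set0 <= d%:E.
    by apply: ge_ereal_sup => _ [[x y] /= [[]]].
  rewrite /U; case: pickle_inv => // p; case: ifPn => // /set_mem Sp.
  apply: le_trans (diam_cell p) _; rewrite lee_fin (le_trans _ Ck)//.
  by rewrite ler_geometric ?Sk// ltW.
pose a n := if pickle_inv n is Some p then (w ^+ (p : nat * nat).1)%:E else 0.
apply: (@le_trans _ _ (\sum_(0 <= i <oo)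
    ((C `^ s)%:E * if i \in pickle @` S then a i else 0))).
  apply: lee_nneseries => [i _ _|i _]; first exact: hausdorff_weight_ge0.
  have w00 : @hausdorff_weight R T s set0 = 0 by rewrite /hausdorff_weight eqxx.
  have rhs0 : 0 <= (C `^ s)%:E * if i \in pickle @` S then a i else 0.
    rewrite mule_ge0 ?lee_fin ?(ltW Cs0)//; case: ifP => // _.
    by rewrite /a; case: pickle_inv => // p; rewrite lee_fin exprn_ge0// ltW.
  move: rhs0; rewrite /U /a.
  case pi : (pickle_inv i) => [p|]; last by rewrite w00.
  case: (boolP (p \in S)) => [/set_mem Sp _|_]; last by rewrite w00.
  rewrite mem_set; first exact: weight_cell.
  by exists p => //; have := @pickle_invK (nat * nat)%type i; rewrite pi.
have a_ge0 i : 0 <= if i \in pickle @` S then a i else 0.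
  by case: ifP => // _; rewrite /a; case: pickle_inv => // p;
    rewrite lee_fin exprn_ge0// ltW.
rewrite nneseriesZl// nneseries_esumT// -esum_mkcond esum_image; last first.
  by move=> p q _ _; exact: (pcan_inj pickleK_inv).
under eq_esum => p _ do rewrite /a pickleK_inv.
apply: le_trans (lee_wpmul2l _ (ltW Seps)) _; first by rewrite lee_fin ltW.
by rewrite -EFinM lee_fin mulrC -ler_pdivlMr// ge_min lexx orbT.
Qed.

End HausdorffContent.

Lemma ereal_between {R : realType} (x y : \bar R) : (x < y)%E ->
  exists r : R, (x < r%:E < y)%E.
Proof.
case: x y => [x| |] [y| |] //=; rewrite ?lte_fin.
- move=> xy; exists ((x + y) / 2); rewrite !lte_fin.
  by rewrite midf_lt// midf_lt.
- by move=> _; exists (x + 1); rewrite lte_fin ltrDl ltr01 ltry.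
- by move=> _; exists (y - 1); rewrite lte_fin gtrBl ltr01 ltNyr.
- by move=> _; exists 0; rewrite ltNyr ltry.
Qed.

Lemma hausdorff_measure_neq0 {R : realType} {T : metricType R} (A : set T) (s : R) :
  0 <= s -> (s%:E < hausdorff_dim A)%E -> hausdorff_measure s A != 0%E.
Proof.
move=> s0; apply: contraTneq => H0; rewrite -leNgt.
by apply: ereal_inf_lbound; exists s.
Qed.

(** * Nets of the target space *)

Section Nets.
Context {R : realType} (B : metricType R) (t : R).
Hypothesis B_neq0 : [set: B] !=set0.
Hypothesis B_dim : (upper_box_dim B < t%:E)%E.

(** A limsup below [t] keeps the quotient below [t] near 0; for [r < 1] the divisor [ln r^-1] is
    positive, so the bound can be exponentiated. *)
Lemma small_covers : exists2 r0 : R, 0 < r0 & forall r, 0 < r < r0 ->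
  exists n (c : 'I_n -> B), (forall x, exists i, mdist x (c i) <= r) /\
    n%:R <= r^-1 `^ t.
Proof.
have [_ [V V0 <-] Vt] := ereal_inf_lt B_dim.
have [e /= e0 eV] : exists2 e : R, 0 < e & forall r, 0 < r < e -> V r.
  move: V0 => [e /= e0 eV]; exists e => // r /andP[r0 re]; apply: eV => //=.
  by rewrite sub0r normrN gtr0_norm.
exists (Num.min e 1); first by rewrite lt_min e0 ltr01.
move=> r; rewrite lt_min => /andP[r0 /andP[re r1]].
have Vr : V r by apply: eV; rewrite r0.
have lnr : 0 < ln r^-1 by rewrite ln_gt0// invf_gt1.
have cr : (covering_number B r < (r^-1 `^ t)%:E)%E.
  rewrite ltNge; apply/negP => rc.
  have : ((lne (covering_number B r) * ((ln r^-1)^-1)%:E) < t%:E)%E.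
    by apply: le_lt_trans Vt; apply: ereal_sup_ubound; exists r.
  rewrite ltNge => /negP; apply.
  rewrite -[leLHS](_ : (t * ln r^-1)%:E * ((ln r^-1)^-1)%:E = _)%E; last first.
    by rewrite -EFinM mulfK// gt_eqF.
  rewrite lee_wpmul2r ?lee_fin ?invr_ge0 ?(ltW lnr)//.
  rewrite -ln_powR -lne_EFin ?powR_gt0 ?invr_gt0// lee_lne// in_itv/=.
    by rewrite leey lee_fin powR_ge0.
  by rewrite leey andbT (le_trans _ rc)// lee_fin powR_ge0.
have [_ [n [c cP] <-]] := ereal_inf_lt cr.
by rewrite lte_fin => /ltW nr; exists n, c.
Qed.

(** A cover of the nonempty [B] has at least one ball, so for some [r < 1] the [t]-th power of
    [r^-1] is at least 1. *)
Lemma box_exponent_ge0 : 0 <= t.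
Proof.
have [r0 r00 r0P] := small_covers; rewrite leNgt; apply/negP => t0.
pose r := Num.min r0 1 / 2.
have r_gt0 : 0 < r by rewrite divr_gt0// lt_min r00 ltr01.
have rlt : r < Num.min r0 1.
  by rewrite /r ltr_pdivrMr// ltr_pMr ?lt_min ?r00 ?ltr01// ltr1n.
move: (rlt); rewrite lt_min => /andP[rr0 r1].
have [|n [c [cP nr]]] := r0P r; first by rewrite r_gt0.
have [b _] := B_neq0; have [i _] := cP b.
have : 1 <= r^-1 `^ t.
  by rewrite (le_trans _ nr)// ler1n (leq_ltn_trans _ (ltn_ord i)).
rewrite leNgt => /negP; apply.
rewrite -[t]opprK powRN invf_lt1 ?powR_gt0 ?invr_gt0//.
have nt0 : 0 < - t by rewrite oppr_gt0.
have := gt0_ltr_powR nt0 (x := 1) (y := r^-1).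
by rewrite powR1 !nnegrE; apply; rewrite ?invf_gt1// invr_ge0 ltW.
Qed.

(** Level 0 is a single point; level [j >= 1] consists of the centres of an economical cover of
    radius [1 / 2 ^+ (j + l)], where the shift [l] brings all radii below [r0]. The parent of a net
    point is any close enough net point one level up. *)
Lemma box_nets : exists (N : nat -> nat) (par : nat -> nat -> nat)
    (net : nat -> nat -> B) (M C : R),
  [/\ N 0 = 1%N, forall j v, (v < N j.+1)%N -> (par j v < N j)%N,
    forall j v, (v < N j.+1)%N -> mdist (net j.+1 v) (net j (par j v)) <= M / 2 ^+ j,
    forall j b, exists2 u, (u < N j)%N & mdist b (net j u) <= M / 2 ^+ j &
    0 <= C /\ forall j, (N j)%:R <= C * (2 `^ t) ^+ j].
Proof.
have [r0 r00 r0P] := small_covers; have [b0 _] := B_neq0.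
have [l lr0] := exists_geometric_lt 1 r00.
have /choice[nc ncP] : forall j, exists nc : nat * (nat -> B),
    (forall b, exists2 u, (u < nc.1)%N & mdist b (nc.2 u) <= 1 / 2 ^+ (j + l)) /\
    nc.1%:R <= (2 `^ t) ^+ (j + l).
  move=> j; have [|n [c [cP nj]]] := r0P (1 / 2 ^+ (j + l)).
    by rewrite divr_gt0 ?exprn_gt0//= (le_lt_trans _ lr0)// ler_geometric// leq_addl.
  exists (n, fun u => if insub u is Some i then c i else b0); split => [b|/=].
    have [i bi] := cP b; exists i; first exact: ltn_ord.
    by rewrite /= insubT//= => lt; rewrite (_ : Sub _ _ = i)//; apply: val_inj.
  move: nj; rewrite mul1r invrK -powR_mulrn// -powRrM mulrC powRrM powR_mulrn// powR_ge0.
pose N j := if j is i.+1 then (nc j).1 else 1%N.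
pose net j u := if j is i.+1 then (nc j).2 u else b0.
(* This bounds the distance from [b0] to any point: at most 1 to a net point of level 1, and from
   there to [b0] at most the sum. *)
pose M := 1 + \sum_(u < N 1%N) mdist b0 (net 1%N u).
have M1 : 1 <= M by rewrite lerDl sumr_ge0// => u _; exact: mdist_ge0.
have net_cover j b : exists2 u, (u < N j)%N & mdist b (net j u) <= M / 2 ^+ j.
  case: j => [|j].
    exists 0%N => //; rewrite expr0 divr1 /=.
    have [u uN bu] := (ncP 1%N).1 b.
    apply: le_trans (metric_triangle _ (net 1%N u) _) _; rewrite lerD//.
      by rewrite (le_trans bu)// mul1r invf_le1 ?exprn_gt0// exprn_ege1// ler1n.
    rewrite metric_sym (bigD1 (Ordinal uN))//= lerDl sumr_ge0// => v _.
    exact: mdist_ge0.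
  have [u uN bu] := (ncP j.+1).1 b; exists u => //; apply: le_trans bu _.
  apply: le_trans (ler_geometric ler01 (leq_addr l j.+1)) _.
  by rewrite ler_wpM2r// invr_ge0 exprn_ge0.
have /choice[par parP] : forall jv : nat * nat, exists u, (u < N jv.1)%N /\
    mdist (net jv.1.+1 jv.2) (net jv.1 u) <= M / 2 ^+ jv.1.
  by move=> [j v]; have [u] := net_cover j (net j.+1 v); exists u.
have p0 k : 0 <= (2 `^ t : R) ^+ k by rewrite exprn_ge0// powR_ge0.
(* In the last constant, 1 pays for the root and the other summand for the shift [l]. *)
exists N, (fun j v => par (j, v)), net, M, (1 + (2 `^ t) ^+ l); split => //.
- by move=> j v _; have [] := parP (j, v).
- by move=> j v _; have [] := parP (j, v).
split=> [|[|j]]; first by rewrite addr_ge0.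
  by rewrite expr0 mulr1 lerDl.
by rewrite mulrDl mul1r -exprD addnC (le_trans (ncP j.+1).2)// lerDr.
Qed.

End Nets.

(** * Ultrametric spaces and self-similar sets *)

Section UniformlyDisconnected.
Context {R : realType} {T B : metricType R} (A : set T) (E : nat -> T -> T -> Prop).
Context (c C : R).
Hypothesis c_gt0 : 0 < c.
Hypothesis C_gt0 : 0 < C.
Hypothesis E_refl : forall k x, A x -> E k x x.
Hypothesis E_sym : forall k x y, E k x y -> E k y x.
Hypothesis E_trans : forall k x y z, E k x y -> E k y z -> E k x z.
Hypothesis E_nested : forall k x y, E k.+1 x y -> E k x y.
Hypothesis E_sep : forall k x y, A x -> A y -> mdist x y < c / 2 ^+ k -> E k x y.
Hypothesis E_dist : forall k x y, A x -> A y -> E k x y -> mdist x y <= C / 2 ^+ k.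
Hypothesis E_countable : forall k, exists ind : T -> nat,
  forall x y, A x -> A y -> ind x = ind y -> E k x y.
Hypothesis E_complete : forall y : nat -> T, (forall k, A (y k)) ->
  (forall k, E k (y k) (y k.+1)) -> exists2 x, A x & forall k, E k x (y k).
Hypothesis B_neq0 : [set: B] !=set0.
Hypothesis B_compact : compact [set: B].

Lemma class_code : exists code : nat -> T -> nat,
  (forall k x y, A x -> A y -> code k x = code k y <-> E k x y) /\
  (forall k x y, code k.+1 x = code k.+1 y -> code k x = code k y).
Proof.
have /choice[ind indP] := E_countable.
(* The code picks one of the indices occurring in the class of [x]; their set, hence the pick, is
   the same for all points of the class. *)
pose S k x := [set n | exists z, [/\ A z, E k x z & ind k z = n]].
(* The code 0 is reserved for the points outside A, so that codes are nested
   on the whole type. *)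
pose code k x := if `[< A x >] then (xget 0%N (S k x)).+1 else 0%N.
have codeE k x y : A x -> A y -> code k x = code k y <-> E k x y.
  move=> Ax Ay; rewrite /code !asboolT//; split=> [[]|xy].
    have inS z : A z -> S k z (xget 0%N (S k z)).
      by move=> Az; apply: xgetPex; exists (ind k z), z; split => //; exact: E_refl.
    have [z [Az xz indz]] := inS _ Ax; have [z' [Az' yz' indz']] := inS _ Ay.
    move=> xy; apply: E_trans xz _; apply: E_trans (E_sym yz').
    by apply: indP => //; rewrite indz indz'.
  congr (xget _ _).+1; apply/seteqP; split=> n [z [Az xz zn]]; exists z; split => //.
    by apply: E_trans xz; exact: E_sym.
  exact: E_trans xy xz.
exists code; split=> // k x y.
have [Ax|nAx] := pselect (A x); have [Ay|nAy] := pselect (A y).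
- by move=> /(codeE _ _ _ Ax Ay)/E_nested/(codeE _ _ _ Ax Ay).
- by rewrite /code (asboolT Ax) (asboolF nAy).
- by rewrite /code (asboolF nAx) (asboolT Ay).
- by rewrite /code (asboolF nAx) (asboolF nAy).
Qed.

(** Two exponents [t < s] fit between the dimensions: [t] bounds the size of the nets, [s] makes the
    content of [A] positive, and [t < s] makes the total budget a convergent series, small for large
    [l]. *)
Lemma lipschitz_onto_of_classes :
  (upper_box_dim B < hausdorff_dim A)%E -> maps_lipschitz_onto A [set: B].
Proof.
move=> /ereal_between[t /andP[Bt tA]].
have [s /andP[ts sA]] := ereal_between tA; rewrite lte_fin in ts.
have t0 := box_exponent_ge0 B_neq0 Bt.
have s0 : 0 < s := le_lt_trans t0 ts.
have [code [codeE code_nested]] := class_code.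
have w01 : 0 < (2 `^ (- s) : R) < 1.
  rewrite powR_gt0//= powRN invf_lt1 ?powR_gt0//.
  by have := gt0_ltr_powR s0 (x := 1) (y := 2);
    rewrite powR1 !nnegrE; apply; rewrite ?ltr1n.
have w0 : 0 < (2 `^ (- s) : R) by case/andP: w01.
have A_gt0 : (0 < content code (2 `^ (- s)) A)%E.
  apply: (content_gt0 C_gt0 s0) => [k x y Ax Ay|].
    by move=> /(codeE _ _ _ Ax Ay); exact: E_dist.
  by apply: hausdorff_measure_neq0 sA; exact: ltW.
have [N [par [net [M [K [N0 par_lt net_par net_cover [K0 NK]]]]]]] := box_nets B_neq0 Bt.
have wt : (2 `^ (- s)) * (2 `^ t) < 1 :> R.
  rewrite powRN mulrC ltr_pdivrMr ?powR_gt0// mul1r -[in ltRHS](subrK t s).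
  rewrite powRD; last by rewrite pnatr_eq0 implybT.
  rewrite ltr_pMl ?powR_gt0//; move: ts; rewrite -subr_gt0 => /gt0_ltr_powR ts.
  by have := ts 1 2; rewrite powR1 !nnegrE; apply; rewrite ?ltr1n.
have [l sum_lt] := nneseries_geometric_small w01 K0 (powR_ge0 2 t) wt NK A_gt0.
have [U [bd UP]] := tree_selection code_nested w0 par_lt sum_lt.
apply: (@lipschitz_onto_of_tree _ _ _ A code c l _ code_nested _ _ B_compact
  N par net M N0 par_lt net_par net_cover U bd) => //.
- by move=> k x y Ax Ay xy; apply/codeE => //; exact: E_sep.
- move=> y Ay yy; have [|x Ax xy] := E_complete Ay.
    by move=> k; apply/codeE.
  by exists x => // k; apply/codeE.
- by move=> j u uN; have [/(_ _ uN)[]] := UP j.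
- by move=> j u uN; have [/(_ _ uN)[]] := UP j.
- by move=> j; have [] := UP j.
- by move=> j; have [] := UP j.
- by move=> j; have [] := UP j.
- by move=> j; have [] := UP j.
Qed.

End UniformlyDisconnected.

(** By the ultrametric inequality, being within [1 / 2 ^+ k] is an equivalence relation. Each class
    contains a point of the countable dense set, which indexes it. *)
Lemma lipschitz_onto_ultrametric {R : realType} (A B : metricType R) :
  [set: B] !=set0 -> compact [set: B] ->
  separable_space A -> complete_space A -> ultrametric A ->
  (upper_box_dim B < hausdorff_dim [set: A])%E ->
  maps_lipschitz_onto [set: A] [set: B].
Proof.
move=> B0 Bc [D Dcount Ddense] Acomplete Aultra.
pose E k (x y : A) := mdist x y <= 1 / 2 ^+ k.
have E_trans k x y z : E k x y -> E k y z -> E k x z.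
  move=> xy yz; apply: le_trans (Aultra x z y) _.
  by rewrite ge_max; apply/andP; split; [|rewrite metric_sym].
have E_sym k x y : E k x y -> E k y x by rewrite /E metric_sym.
have E_nested k x y : E k.+1 x y -> E k x y.
  by move=> /le_trans; apply; exact: ler_geometric ler01 (leqnSn k).
have E_le j k x y : (j <= k)%N -> E k x y -> E j x y.
  by move=> /subnK <-; elim: (k - j)%N => // n IHn /E_nested.
apply: (@lipschitz_onto_of_classes _ _ _ setT E 1 1) => //.
- by move=> k x _; rewrite /E mdistxx divr_ge0// exprn_ge0.
- by move=> k x y _ _ /ltW.
- move=> k; have /countable_injP[ind indP] := Dcount.
  have /choice[d dP] : forall x, exists z, D z /\ E k x z.
    move=> x; have k0 : 0 < 1 / 2 ^+ k :> R by rewrite divr_gt0// exprn_gt0.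
    have [|z [xz Dz]] := Ddense (ball x (1 / 2 ^+ k))° _ (open_interior _).
      by exists x; exact: nbhsx_ballx.
    exists z; split => //; move: xz => /interior_subset.
    by rewrite ballEmdist => /ltW.
  exists (ind \o d) => x y _ _ /= dxy.
  have [Dx xd] := dP x; have [Dy yd] := dP y.
  apply: E_trans xd _; apply: E_sym.
  by rewrite (indP _ _ _ _ dxy) ?inE.
- move=> y _ yE.
  have tail j k : (j <= k)%N -> E j (y j) (y k).
    move=> /subnKC <-; elim: (k - j)%N => [|n IHn].
      by rewrite addn0 /E mdistxx divr_ge0// exprn_ge0.
    rewrite addnS; apply: E_trans IHn _; apply: E_le (yE _); exact: leq_addr.
  have [|x yx] := Acomplete (y @ \oo) _.
    apply: cauchy_exP => e e0.
    have [k ke] := exists_geometric_lt 1 e0.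
    exists (y k), k => // n /= kn; rewrite ballEmdist /=.
    exact: le_lt_trans (tail _ _ kn) ke.
  exists x => // k.
  have k0 : 0 < 1 / 2 ^+ k :> R by rewrite divr_gt0// exprn_gt0.
  have [n _ nP] := yx _ (nbhsx_ballx x _ k0).
  have := nP (maxn n k) (leq_maxl _ _); rewrite /= ballEmdist => /ltW xn.
  apply: E_trans xn _; apply: E_sym; apply: tail; exact: leq_maxr.
Qed.

Lemma finite_lower_bound {R : realType} (I : finType) (g : I -> R) :
  (forall i, 0 < g i) -> exists2 e, 0 < e & forall i, e <= g i.
Proof.
(* Starting the minimum at 1 covers an empty [I]. *)
move=> g0; exists (\big[Num.min/1]_i g i); last by move=> i; exact: bigmin_le_cond.
by apply: lt_bigmin.
Qed.

(** * Self-similar sets with separated pieces *)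

Section SelfSimilarSets.
Context {R : realType} {X : metricType R} (m : nat) (f : 'I_m -> X -> X) (r : 'I_m -> R).
Context (K : set X).
Hypothesis K_neq0 : K !=set0.
Hypothesis K_compact : compact K.
Hypothesis r01 : forall i, 0 < r i < 1.
Hypothesis f_sim : forall i x y, mdist (f i x) (f i y) = r i * mdist x y.
Hypothesis K_fix : K = \bigcup_i (f i @` K).
Hypothesis K_ssc : forall i j, i != j -> f i @` K `&` f j @` K = set0.

Lemma piece_sub i x : K x -> K (f i x).
Proof. by move=> Kx; rewrite K_fix; exists i => //; exists x. Qed.

Lemma piece_of x : K x -> exists i, (f i @` K) x.
Proof.
move=> Kx; have [i _ fx] : (\bigcup_i (f i @` K)) x by rewrite -K_fix.
by exists i.
Qed.

Lemma compact_bounded_dist :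
  exists2 D, 0 < D & forall x y, K x -> K y -> mdist x y <= D.
Proof.
have [x0 Kx0] := K_neq0.
suff [D xD] : exists D, forall x, K x -> mdist x0 x <= D.
  have D0 : 0 <= D by rewrite (le_trans _ (xD _ Kx0))// mdist_ge0.
  exists (D + D + 1) => [|x y Kx Ky]; first by rewrite ltr_wpDl// addr_ge0.
  apply: le_trans (metric_triangle _ x0 _) _.
  by rewrite metric_sym ler_wpDr// lerD// xD.
apply: contrapT => /forallNP nD.
have /choice[x xP] : forall k : nat, exists x, K x /\ k%:R < mdist x0 x.
  move=> k; have /existsNP[x /not_implyP[Kx /negP]] := nD k%:R.
  by rewrite -ltNge; exists x.
have [p Kp pP] := compact_seq_cluster K_compact (fun k => (xP k).1).
have d0 : 0 <= mdist x0 p + 1 by rewrite addr_ge0 ?mdist_ge0.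
have [k] := pP 1 (Num.bound (mdist x0 p + 1)) ltr01.
move=> bk pk; have := archi_boundP d0; rewrite ltNge => /negP; apply.
apply: (@le_trans _ _ k%:R); first by rewrite ler_nat.
apply: ltW; apply: lt_le_trans (xP k).2 _.
by apply: le_trans (metric_triangle _ p _) _; rewrite lerD2l ltW.
Qed.

(** If two pieces came arbitrarily close, a cluster point [p] on one side and then a cluster point
    [q] on the other would give [f i p = f j q]. A minimum over the finitely many pairs gives one
    [d]. *)
Lemma separated_pieces : exists2 d, 0 < d & forall i j x y, i != j -> K x -> K y ->
  d <= mdist (f i x) (f j y).
Proof.
suff /choice[g gP] : forall ij : 'I_m * 'I_m, exists d, 0 < d /\
    forall x y, ij.1 != ij.2 -> K x -> K y -> d <= mdist (f ij.1 x) (f ij.2 y).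
  have [d d0 dg] := finite_lower_bound (fun ij => (gP ij).1).
  exists d => // i j x y ij Kx Ky; apply: le_trans (dg (i, j)) _.
  exact: (gP (i, j)).2.
move=> [i j] /=; have [->|ij] := eqVneq i j; first by exists 1; split => // x y /eqP.
apply: contrapT => /forallNP nd.
have /choice[x xP] : forall k, exists x, K x /\ exists y, K y /\
    mdist (f i x) (f j y) < 1 / 2 ^+ k.
  move=> k; apply: contrapT => /forallNP nx; apply: (nd (1 / 2 ^+ k)).
  split=> [|x y _ Kx Ky]; first by rewrite divr_gt0// exprn_gt0.
  by rewrite leNgt; apply/negP => xy; apply: (nx x); split => //; exists y.
have f_le l u v : mdist (f l u) (f l v) <= mdist u v.
  by rewrite f_sim ler_piMl ?mdist_ge0// ltW//; case/andP: (r01 l).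
have [p Kp pP] := compact_seq_cluster K_compact (fun k => (xP k).1).
have /choice[z zP] : forall k, exists y, K y /\ mdist (f i p) (f j y) <= 2 / 2 ^+ k.
  move=> k; have k0 : 0 < 1 / 2 ^+ k :> R by rewrite divr_gt0// exprn_gt0.
  have [l kl pl] := pP _ k k0; have [_ [y [Ky xy]]] := xP l; exists y; split => //.
  apply: le_trans (metric_triangle _ (f i (x l)) _) _.
  rewrite (_ : 2 = 1 + 1 :> R); last by ring.
  rewrite mulrDl; apply: lerD; first exact: le_trans (f_le _ _ _) (ltW pl).
  exact: le_trans (ltW xy) (ler_geometric ler01 kl).
have [q Kq qP] := compact_seq_cluster K_compact (fun k => (zP k).1).
suff pq : f i p = f j q.
  have : (f i @` K `&` f j @` K) (f i p) by split; [exists p|rewrite pq; exists q].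
  by rewrite K_ssc.
apply: mdist_positivity; apply/eqP; rewrite eq_le mdist_ge0 andbT.
apply: (@le0_geometric _ _ 3) => k.
have k0 : 0 < 1 / 2 ^+ k :> R by rewrite divr_gt0// exprn_gt0.
have [l kl ql] := qP _ k k0; have [_ pz] := zP l.
apply: le_trans (metric_triangle _ (f j (z l)) _) _.
rewrite (_ : 3 = 2 + 1 :> R); last by ring.
rewrite mulrDl lerD//.
  exact: le_trans pz (ler_geometric (ler0n _ 2) kl).
by apply: le_trans (f_le _ _ _) _; rewrite metric_sym ltW.
Qed.

(** The first letter is applied last, so that extending a word on the right passes to a subpiece. *)
Definition word_map (w : seq 'I_m) (x : X) := foldr f x w.

Definition word_ratio (w : seq 'I_m) : R := \prod_(i <- w) r i.

Lemma word_ratio_gt0 w : 0 < word_ratio w.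
Proof. by apply: prodr_gt0 => i _; case/andP: (r01 i). Qed.

Lemma word_map_sim w x y :
  mdist (word_map w x) (word_map w y) = word_ratio w * mdist x y.
Proof.
elim: w => [|i w IHw]; first by rewrite /word_ratio big_nil mul1r.
by rewrite /= f_sim IHw /word_ratio big_cons mulrA.
Qed.

Lemma word_map_rcons w i x : word_map (rcons w i) x = word_map w (f i x).
Proof. by rewrite /word_map foldr_rcons. Qed.

(** Induction on the right end of [w]: [z] lies in the parent piece, whose bound is weaker, and
    there siblings are at least [d] times the parent's ratio apart. *)
Lemma word_separated d : 0 < d ->
  (forall i j x y, i != j -> K x -> K y -> d <= mdist (f i x) (f j y)) ->
  forall w y z, (word_map w @` K) y -> K z -> mdist y z < d * word_ratio w ->
    (word_map w @` K) z.
Proof.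
move=> d0 dP; elim/last_ind => [|w i IHw] y z; first by move=> _ Kz _; exists z.
move=> [x Kx <-] Kz; rewrite word_map_rcons => xz.
have ratioE : word_ratio (rcons w i) = word_ratio w * r i.
  by rewrite /word_ratio -cats1 big_cat big_seq1.
have xz' : mdist (word_map w (f i x)) z < d * word_ratio w.
  apply: lt_le_trans xz _; rewrite ratioE ler_wpM2l ?(ltW d0)//.
  by rewrite ler_piMr ?(ltW (word_ratio_gt0 w))// ltW//; case/andP: (r01 i).
have [|u Ku uz] := IHw (word_map w (f i x)) z _ Kz xz'.
  by exists (f i x) => //; exact: piece_sub.
have [j [v Kv vu]] := piece_of Ku.
exists v => //; rewrite word_map_rcons -uz -vu; congr (word_map w (f _ v)).
apply: contrapT => /eqP ij.
move: xz'; rewrite -uz -vu word_map_sim mulrC ltr_pM2r ?word_ratio_gt0//.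
by rewrite ltNge dP.
Qed.

(** The address of [x] is followed until the ratio first drops to [t] or below; it was above [t]
    before, and the last letter multiplies it by at least [e]. *)
Lemma word_of_scale e t x : 0 < t <= 1 -> (forall i, e <= r i) -> 0 <= e <= 1 -> K x ->
  exists w, (word_map w @` K) x /\ e * t <= word_ratio w <= t.
Proof.
move=> /andP[t0 t1] er /andP[e0 e1] Kx.
have [h h0 hP] : exists2 h, 0 < h & forall i, h <= 1 - r i.
  by apply: finite_lower_bound => i; rewrite subr_gt0; case/andP: (r01 i).
pose q := 1 - Num.min h 1.
have q0 : 0 <= q by rewrite subr_ge0 ge_min lexx orbT.
have q1 : q < 1 by rewrite gtrBl lt_min h0 ltr01.
have rq i : r i <= q by rewrite lerBrDr addrC -lerBrDr ge_min hP.
have e_t : e * t <= 1.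
  by apply: le_trans (ler_wpM2r (ltW t0) e1) _; rewrite mul1r.
(* Either the descent has stopped or the ratio is at most [q ^+ k], which is below [t] for large
   [k]. *)
have descend k : exists w, [/\ (word_map w @` K) x, e * t <= word_ratio w &
    word_ratio w <= t \/ word_ratio w <= q ^+ k].
  elim: k => [|k [w [wx ew wk]]].
    by exists [::]; rewrite /word_ratio big_nil; split; [exists x| |right].
  have [wt|tw] := leP (word_ratio w) t; first by exists w; split => //; left.
  have {}wk : word_ratio w <= q ^+ k by case: wk => // /(lt_le_trans tw); rewrite ltxx.
  move: wx => [u Ku ux]; have [i [v Kv vu]] := piece_of Ku.
  have /andP[ri0 _] := r01 i.
  exists (rcons w i); rewrite /word_ratio -cats1 big_cat big_seq1 -/(word_ratio w).
  split; first by exists v => //; rewrite cats1 word_map_rcons vu.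
    by rewrite [leRHS]mulrC ler_pM ?(ltW t0) ?(ltW tw)// ltW.
  by right; rewrite exprSr ler_pM ?(ltW (word_ratio_gt0 w)) ?(ltW ri0).
have /cvgrPdist_lt/(_ t t0)[k _ /(_ k (leqnn k))] : geometric 1 q @ \oo --> (0 : R).
  by apply: cvg_geometric; rewrite ger0_norm.
rewrite /= sub0r normrN mul1r ger0_norm ?exprn_ge0// => qt.
have [w [wx ew wk]] := descend k; exists w; split => //; rewrite ew/=.
by case: wk => // /le_trans; apply; exact: ltW.
Qed.

(** Level-[k] classes are linked by chains of steps below [c / 2 ^+ k]. By [word_separated] such a
    chain stays inside a piece of ratio about [1 / 2 ^+ k], which bounds the diameter of the
    class. *)
Lemma lipschitz_onto_self_similar (B : metricType R) :
  [set: B] !=set0 -> compact [set: B] ->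
  (upper_box_dim B < hausdorff_dim K)%E -> maps_lipschitz_onto K [set: B].
Proof.
move=> B0 Bc BK.
have [D D0 DP] := compact_bounded_dist.
have [d d0 dP] := separated_pieces.
have [e0 e00 e0P] : exists2 e, 0 < e & forall i, e <= r i.
  by apply: finite_lower_bound => i; case/andP: (r01 i).
pose e := Num.min e0 1.
have e_gt0 : 0 < e by rewrite lt_min e00 ltr01.
have k01 k : 0 < 1 / 2 ^+ k <= (1 : R).
  by rewrite divr_gt0 ?exprn_gt0//= mul1r invf_le1 ?exprn_gt0// exprn_ege1// ler1n.
have word k x : K x -> exists w, (word_map w @` K) x /\
    e * (1 / 2 ^+ k) <= word_ratio w <= 1 / 2 ^+ k.
  apply: word_of_scale => // [i|]; first by rewrite ge_min e0P.
  by rewrite (ltW e_gt0) ge_min lexx orbT.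
(* A piece of ratio at least [e / 2 ^+ k] is at distance at least [d * e / 2 ^+ k] from the rest of
   [K]. *)
pose c := d * e; have c0 : 0 < c by rewrite mulr_gt0.
pose chained k (P : set X) := forall y z, P y -> K y -> K z ->
  mdist y z < c / 2 ^+ k -> P z.
(* [E k x y] says that x and y are joined in K by a chain of steps < c / 2^k. *)
pose E k x y := forall P, chained k P -> P x <-> P y.
have E_sep k x y : K x -> K y -> mdist x y < c / 2 ^+ k -> E k x y.
  move=> Kx Ky xy P cP; split=> [Px|Py]; first exact: cP Px Kx Ky xy.
  by apply: cP Py Ky Kx _; rewrite metric_sym.
have E_sym k x y : E k x y -> E k y x.
  by move=> xy P cP; have [? ?] := xy P cP; split.
have E_trans k x y z : E k x y -> E k y z -> E k x z.
  by move=> xy yz P cP; have [? ?] := xy P cP; have [? ?] := yz P cP; split; auto.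
have E_nested k x y : E k.+1 x y -> E k x y.
  move=> xy P cP; apply: xy => y' z' Py Ky Kz yz; apply: cP Py Ky Kz _.
  exact: lt_le_trans yz (ler_geometric (ltW c0) (leqnSn k)).
have E_le j k x y : (j <= k)%N -> E k x y -> E j x y.
  move=> /subnK <-; elim: (k - j)%N => [//|n IHn] xy.
  exact: IHn (E_nested _ _ _ xy).
have diam_word w x y : (word_map w @` K) x -> (word_map w @` K) y ->
    mdist x y <= D * word_ratio w.
  move=> [u Ku <-] [v Kv <-]; rewrite word_map_sim mulrC.
  by rewrite ler_wpM2r ?DP// ltW// word_ratio_gt0.
apply: (@lipschitz_onto_of_classes _ _ _ K E c D) => //.
- move=> k x y Kx Ky xy; have [w [wx /andP[ew wk]]] := word k x Kx.
  have wP : chained k (word_map w @` K).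
    move=> y' z' Py _ Kz yz; apply: (word_separated d0 dP Py Kz).
    apply: lt_le_trans yz _; rewrite -mulrA ler_wpM2l ?(ltW d0)//.
    by move: ew; rewrite mul1r.
  apply: le_trans (diam_word w x y wx _) _; first exact/(xy _ wP).
  by rewrite -[(2 ^+ _)^-1]mul1r ler_wpM2l// ltW.
(* Points sharing a word whose piece has diameter below [c / 2 ^+ k] are one step apart, and words
   are countably many. *)
- move=> k; have ck0 : 0 < c / 2 ^+ k by rewrite divr_gt0// exprn_gt0.
  have [j jP] := exists_geometric_lt D ck0.
  have /choice[v vP] : forall x, exists w, K x -> (word_map w @` K) x /\
      word_ratio w <= 1 / 2 ^+ j.
    move=> x; have [/(word j)[w [wx /andP[_ wj]]]|nK] := pselect (K x).
      by exists w.
    by exists [::].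
  exists (pickle \o v) => x y Kx Ky /(pcan_inj pickleK) vxy.
  apply: E_sep => //; apply: le_lt_trans jP.
  have [wx wj] := vP _ Kx; have [wy _] := vP _ Ky.
  apply: le_trans (diam_word _ _ _ wx _) _; first by rewrite vxy.
  by rewrite -[(2 ^+ _)^-1]mul1r ler_wpM2l// ltW.
(* For every [k], a cluster point of [y] is one step from some [y j] with [j >= k], which is linked
   to [y k]. *)
- move=> y Ky yE.
  have [p Kp pP] := compact_seq_cluster K_compact Ky.
  exists p => // k; have ck0 : 0 < c / 2 ^+ k by rewrite divr_gt0// exprn_gt0.
  have [j kj pj] := pP _ k ck0.
  apply: (E_trans _ _ _ _ (E_sep _ _ _ Kp (Ky j) pj)); apply: E_sym.
  move: kj => /subnKC <-; elim: (j - k)%N => [|n IHn]; first by rewrite addn0.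
  rewrite addnS; apply: (E_trans _ _ _ _ IHn); apply: E_le (yE _); exact: leq_addr.
Qed.

End SelfSimilarSets.

(** * Lipschitz maps onto a compact metric space *)

Local Open Scope classical_set_scope.
Local Open Scope ereal_scope.

Theorem corollary1p7 (R : realType) (B : metricType R)
    (B_nonempty : [set: B] !=set0) (B_compact : compact [set: B]) :
  (forall A : metricType R,
      separable_space A -> complete_space A -> ultrametric A ->
      upper_box_dim B < hausdorff_dim [set: A] ->
      maps_lipschitz_onto [set: A] [set: B]) /\
  (forall (n : nat) (A : set (euclid R n)),
      self_similar_ssc A ->
      upper_box_dim B < hausdorff_dim A ->
      maps_lipschitz_onto A [set: B]).
Proof.
split=> [A|n A]; first exact: lipschitz_onto_ultrametric.
move=> [m [f [[A0 Ac f_contr A_fix] ssc]]].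
have /choice[r rP] : forall i, exists r : R, (0 < r < 1)%R /\
    forall x y, mdist (f i x) (f i y) = (r * mdist x y)%R.
  by move=> i; have [r] := f_contr i; exists r.
apply: (@lipschitz_onto_self_similar _ _ _ f r A A0 Ac) => //.
- by move=> i; have [] := rP i.
- by move=> i; have [] := rP i.
- move=> i j; rewrite -val_eqE neq_ltn => /orP[|] ij; first exact: ssc.
  by rewrite setIC ssc.
Qed.
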